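(* Let $\nu(x;q)$ be a real-valued function defined for $x>0$ and $0<q<1$ such that (i) for each fixed $q$, $\nu(x;q)$ is decreasing in $x$; (ii) $\nu(x;q)-\nu(x+1;q)=g_q(x)$ for all $x>0$, $0<q<1$; (iii) $\nu(1;q)=\sum_{n=0}^\infty g_q(1+n)$ for all $0<q<1$. Then $\nu(x;q)=\sum_{n=0}^\infty g_q(x+n)$ for all $x>0$ and $0<q<1$.
   Context: For $0<q<1$ and $x>0$ define $$g_q(x)=\left(x+\tfrac12\right)\log\left(\frac{1-q^{x+1}}{1-q^{x}}\right)+\frac{1}{\log q}\int_{-x\log q}^{-(x+1)\log q}\frac{u}{e^u-1}\,du .$$ Equivalently $g_q(x)=\mu_q(x)-\mu_q(x+1)$, where $$\mu_q(x)=\log\Gamma_q(x)-\left(x-\tfrac12\right)\log\left(\frac{1-q^x}{1-q}\right)-\frac{1}{\log q}\int_0^{-x\log q}\frac{u}{e^u-1}\,du-M_q,$$ $M_q=\log\sqrt{1-q}+\log(q;q)_\infty-\frac{\pi^2}{6\log q}$, $\Gamma_q(x)=\frac{(q;q)_\infty}{(q^x;q)_\infty}(1-q)^{1-x}$ and $(a;q)_\infty=\prod_{k=0}^\infty(1-aq^k)$. Since $\mu_q(x)\to0$ as $x\to\infty$, the series $\sum_{n\ge0}g_q(x+n)$ converges for every $x>0$. *)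

(* Defs.v *)
From Stdlib Require Import Reals.
From Coquelicot Require Import Coquelicot.

Open Scope R_scope.

(* Meant for [0 < q < 1] and [0 < x]: then the interval of integration is
   contained in the positive half-line and the integrand is continuous on it. *)
Definition g (q x : R) : R :=
  (x + 1 / 2) * ln ((1 - Rpower q (x + 1)) / (1 - Rpower q x))
  + / ln q * RInt (fun u : R => u / (exp u - 1))
                  (- x * ln q) (- (x + 1) * ln q).

(* Main.v *)
Require Import Defs.
From Stdlib Require Import Reals Lra.
From Coquelicot Require Import Coquelicot.
Open Scope R_scope.

(** Hypothesis (ii) telescopes to [sum_{k <= n} g_q(x + k) = nu(x) - nu(x + n + 1)],
    so everything reduces to [nu(x + n + 1) -> 0]. The integral term of [g_q] is
    nonpositive, hence [g_q(x) <= (x + 1/2) q^x] for [x >= 1], which makes the series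
    at [x = 1] converge; with (iii) this gives [nu(n) -> 0] along the integers, and
    monotonicity squeezes [nu(x + n + 1)] between [0] and [nu(n + 1)]. *)

Lemma ln_le_sub1 (y : R) : 0 < y -> ln y <= y - 1.
Proof.
intros Hy.
assert (H := exp_ineq1_le (ln y)).
rewrite exp_ln in H by assumption.
lra.
Qed.

Lemma Rpower_base_lt1 (q x : R) : 0 < q < 1 -> 0 < x -> 0 < Rpower q x < 1.
Proof.
intros Hq Hx.
assert (Hl : ln q < 0) by (rewrite <- ln_1; apply ln_increasing; lra).
split; [apply exp_pos|].
unfold Rpower; rewrite <- exp_0.
apply exp_increasing; nra.
Qed.

Lemma RInt_bose_ge0 (a b : R) :
  0 < a -> a <= b -> 0 <= RInt (fun u : R => u / (exp u - 1)) a b.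
Proof.
intros Ha Hab.
assert (Hexp : forall u, 0 < u -> 0 < exp u - 1).
{ intros u Hu; generalize (exp_ineq1 u); lra. }
apply RInt_ge_0; [assumption| |].
- apply (ex_RInt_continuous (V := R_CompleteNormedModule)).
  intros u; rewrite Rmin_left by assumption; intros [Hu _].
  apply (ex_derive_continuous (fun u : R => u / (exp u - 1))).
  auto_derive.
  generalize (Hexp u); lra.
- intros u Hu.
  apply Rlt_le, Rdiv_lt_0_compat; [lra|apply Hexp; lra].
Qed.

(** Once the integral term is dropped, [ln t <= t - 1] bounds the logarithm by
    [q^x (1 - q) / (1 - q^x)]. For [x >= 1] one has [q^x <= q], so the factor [(1 - q) / (1 - q^x)]
    is at most 1. *)
Lemma g_le (q x : R) :
  0 < q < 1 -> 1 <= x -> g q x <= (x + 1 / 2) * Rpower q x.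
Proof.
intros Hq Hx.
assert (Hl : ln q < 0) by (rewrite <- ln_1; apply ln_increasing; lra).
(* Since [ln q < 0], the bounds of integration are positive and in increasing order, so the integral
   is nonnegative while its prefactor is negative. *)
assert (Hint : / ln q * RInt (fun u : R => u / (exp u - 1))
                  (- x * ln q) (- (x + 1) * ln q) <= 0).
{ assert (Hi := Rinv_lt_0_compat _ Hl).
  assert (Hr := RInt_bose_ge0 (- x * ln q) (- (x + 1) * ln q)
                  ltac:(nra) ltac:(nra)).
  nra. }
assert (Hp : 0 < Rpower q x < 1) by (apply Rpower_base_lt1; lra).
assert (Hpq : Rpower q x <= q).
{ rewrite <- (Rpower_1 q) at 2 by lra.
  unfold Rpower.
  destruct Hx as [Hx| <-]; [|lra].
  apply Rlt_le, exp_increasing; nra. }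
assert (Hln : ln ((1 - Rpower q (x + 1)) / (1 - Rpower q x)) <= Rpower q x).
{ rewrite Rpower_plus, Rpower_1 by lra.
  apply Rle_trans with ((1 - Rpower q x * q) / (1 - Rpower q x) - 1).
  - apply ln_le_sub1, Rdiv_lt_0_compat; nra.
  - replace ((1 - Rpower q x * q) / (1 - Rpower q x) - 1)
      with (Rpower q x * (1 - q) / (1 - Rpower q x)) by (field; lra).
    apply Rle_div_l; nra. }
unfold g.
nra.
Qed.

(** Ratio test: consecutive terms have ratio [q + q / (n + c)], which tends to [q < 1]. *)
Lemma ex_series_linear_geom (q c : R) :
  0 < q < 1 -> 0 < c -> ex_series (fun n : nat => (INR n + c) * q ^ n).
Proof.
intros Hq Hc.
assert (Hpos : forall n : nat, 0 < (INR n + c) * q ^ n).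
{ intros n; generalize (pos_INR n) (pow_lt q n (proj1 Hq)); nra. }
apply ex_series_ext with (fun n : nat => Rabs ((INR n + c) * q ^ n)).
{ intros n; apply Rabs_pos_eq, Rlt_le, Hpos. }
apply ex_series_DAlembert with q; [apply Hq| |].
{ intros n; apply Rgt_not_eq, Hpos. }
apply is_lim_seq_ext with (fun n : nat => q + q * / (INR n + c)).
{ intros n.
  rewrite Rabs_pos_eq by (apply Rlt_le, Rdiv_lt_0_compat; apply Hpos).
  rewrite S_INR; simpl; field.
  generalize (pos_INR n) (pow_lt q n (proj1 Hq)); split; lra. }
replace (Finite q) with (Finite (q + q * 0)) by (f_equal; ring).
apply is_lim_seq_plus'; [apply is_lim_seq_const|].
apply (is_lim_seq_scal_l _ q (Finite 0)).
apply (is_lim_seq_inv _ p_infty); [|discriminate].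
apply is_lim_seq_le_p_loc with INR; [|apply is_lim_seq_INR].
exists 0%nat; intros n _; lra.
Qed.

(** Comparison with the previous series at [c = 3/2]. As [g_le] bounds [g] only from above, the
    nonnegativity hypothesis is what turns it into a bound on the absolute value. *)
Lemma ex_series_g1 (q : R) :
  0 < q < 1 -> (forall n : nat, 0 <= g q (1 + INR n)) ->
  ex_series (fun n : nat => g q (1 + INR n)).
Proof.
intros Hq Hg.
apply (ex_series_le (V := R_CompleteNormedModule)) with
  (b := fun n : nat => q * ((INR n + 3 / 2) * q ^ n)).
- intros n.
  change (Rabs (g q (1 + INR n)) <= q * ((INR n + 3 / 2) * q ^ n)).
  rewrite Rabs_pos_eq by apply Hg.
  eapply Rle_trans.
  + apply g_le; [assumption|generalize (pos_INR n); lra].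
  + rewrite Rpower_plus, Rpower_1, Rpower_pow by lra.
    right; field.
- apply (ex_series_scal (V := R_NormedModule)), ex_series_linear_geom; lra.
Qed.

Lemma sum_n_telescope (f u : R -> R) (x : R) :
  0 < x -> (forall y, 0 < y -> f y - f (y + 1) = u y) ->
  forall n : nat,
    sum_n (fun k : nat => u (x + INR k)) n = f x - f (x + INR n + 1).
Proof.
intros Hx Hu n.
induction n as [|n IH].
- rewrite sum_O; simpl INR.
  rewrite Rplus_0_r, Hu; auto.
- rewrite sum_Sn, IH.
  change (@eq R (f x - f (x + INR n + 1) + u (x + INR (S n)))
                (f x - f (x + INR (S n) + 1))).
  rewrite <- Hu by (generalize (pos_INR (S n)); lra).
  rewrite S_INR, <- (Rplus_assoc x (INR n) 1).
  ring.
Qed.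

Theorem theorem8p2 (nu : R -> R -> R)
  (nu_decreasing : forall q : R, 0 < q < 1 ->
     forall x y : R, 0 < x -> x <= y -> nu y q <= nu x q)
  (nu_difference : forall q x : R, 0 < q < 1 -> 0 < x ->
     nu x q - nu (x + 1) q = g q x)
  (nu_one : forall q : R, 0 < q < 1 ->
     nu 1 q = Series (fun n : nat => g q (1 + INR n))) :
  forall x q : R, 0 < x -> 0 < q < 1 ->
    is_series (fun n : nat => g q (x + INR n)) (nu x q).
Proof.
intros x q Hx Hq.
assert (Htel := fun y Hy => sum_n_telescope (fun z => nu z q) (g q) y Hy
                  (fun z => nu_difference q z Hq)).
(* By (ii) each term is a difference [nu(y) - nu(y + 1)], nonnegative by monotonicity. *)
assert (Hg : forall n : nat, 0 <= g q (1 + INR n)).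
{ intros n; assert (Hn := pos_INR n).
  rewrite <- nu_difference by lra.
  generalize (nu_decreasing q Hq (1 + INR n) (1 + INR n + 1)); lra. }
assert (H1 : is_lim_seq (fun n : nat => nu (1 + INR n + 1) q) 0).
{ assert (Hs := Series_correct _ (ex_series_g1 q Hq Hg)).
  rewrite <- nu_one in Hs by assumption.
  apply is_lim_seq_ext with
    (fun n : nat => nu 1 q - sum_n (fun k : nat => g q (1 + INR k)) n).
  { intros n; rewrite Htel by lra; ring. }
  replace 0 with (nu 1 q - nu 1 q) by ring.
  apply is_lim_seq_minus'; [apply is_lim_seq_const|exact Hs]. }
assert (Hnonneg : forall y, 0 < y -> 0 <= nu y q).
{ intros y Hy.
  (* For all integers beyond [y], monotonicity puts [nu] at the integer below [nu y q]; the limit 0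
     of the former is then a lower bound. *)
  destruct (INR_unbounded y) as [N HN].
  apply (is_lim_seq_le_loc (fun n : nat => nu (1 + INR n + 1) q)
           (fun _ : nat => nu y q) 0 (nu y q)).
  - exists N; intros n Hn; apply le_INR in Hn.
    apply nu_decreasing; lra.
  - exact H1.
  - apply is_lim_seq_const. }
assert (Hlim : is_lim_seq (fun n : nat => nu (x + INR n + 1) q) 0).
(* The shift by one makes the argument [x + (n + 1) + 1], which exceeds [1 + n + 1] for every
   [x > 0]; unshifted, the comparison would fail when [x < 1]. *)
{ apply is_lim_seq_incr_1.
  apply is_lim_seq_le_le with
    (fun _ : nat => 0) (fun n : nat => nu (1 + INR n + 1) q).
  - intros n; rewrite S_INR; assert (Hn := pos_INR n); split.
    + apply Hnonneg; lra.
    + apply nu_decreasing; lra.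
  - apply is_lim_seq_const.
  - exact H1. }
assert (Hsum : is_lim_seq (sum_n (fun n : nat => g q (x + INR n))) (nu x q)).
{ apply is_lim_seq_ext with (fun n : nat => nu x q - nu (x + INR n + 1) q).
  { intros n; symmetry; apply Htel, Hx. }
  replace (Finite (nu x q)) with (Finite (nu x q - 0)) by (f_equal; ring).
  apply is_lim_seq_minus'; [apply is_lim_seq_const|exact Hlim]. }
exact Hsum.
Qed.
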